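(* If $m \in \{8,40,42,50,74,76,80,86,100,130,144,150\}$, then there is no self-orthogonal $7$-$(24m,4m+4,\lambda_7)$ design, where $$\lambda_7 = \binom{5m-2}{m-1}\frac{(4m-1)(4m-2)}{(24m-5)(24m-6)}.$$
   Context: A $t$-$(v,k,\lambda)$ design is a pair $(X,\mathcal{B})$ where $|X|=v$ and $\mathcal{B}$ is a collection of $k$-subsets of $X$ (blocks) such that every $t$-subset of $X$ is contained in exactly $\lambda$ blocks. A $t$-$(v,k,\lambda)$ design is self-orthogonal if the intersection of any two blocks has the same parity as the block size $k$. *)

(* Defs.v *)
From mathcomp Require Import all_boot all_order all_algebra.

Set Implicit Arguments.
Unset Strict Implicit.
Unset Printing Implicit Defensive.

(* Blocks form a finite multiset, represented by a sequence: repeated blocks   *)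
(* are allowed and counted with multiplicity. A duplicate-free sequence is the *)
(* same thing as a simple design.                                              *)
Definition is_design (t v k lambda : nat) (X : finType) (Bs : seq {set X}) :
    Prop :=
  [/\ #|X| = v,
      forall B, B \in Bs -> #|B| = k
    & forall T : {set X}, #|T| = t ->
        count (fun B : {set X} => T \subset B) Bs = lambda].

Definition is_self_orthogonal_design (t v k lambda : nat) (X : finType)
    (Bs : seq {set X}) : Prop :=
  is_design t v k lambda Bs /\
  (forall B1 B2, B1 \in Bs -> B2 \in Bs -> odd #|B1 :&: B2| = odd k).

(* Main.v *)
Require Import Defs.
From mathcomp Require Import all_boot all_order all_algebra.
From mathcomp Require Import zify ring.
Import GRing.Theory.
Local Open Scope ring_scope.

(** Put x = |B :&: B'| for a fixed block B and a variable block B'.  Double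
    counting in a 6-design gives the sums over B' of the falling factorials
    x ^_ l, l <= 6, hence the sum of x (x - 2) (x - 4) (x - 6) (x - 8) (x - 10).
    When all x are even, each term is 2^6 6! 'C(x/2, 6), a multiple of 2^10.
    In terms of the parameter lambda_4, the sum is lambda_4 times a rational
    number which has 2-adic valuation exactly 5 for every even m; therefore 32
    divides lambda_4, that is, 32 m divides lambda_5.  The prescribed lambda_7
    corresponds to lambda_5 = 'C(5 m - 2, m - 1), and Legendre's formula shows
    that 32 m does not divide this binomial coefficient for the listed m. *)

Local Open Scope nat_scope.

Lemma exists_set_of_card (X : finType) t :
  t <= #|X| -> exists T : {set X}, #|T| = t.
Proof.
move=> tX; have : 0 < #|[set A : {set X} | A \subset [set: X] & #|A| == t]|.
  by rewrite cards_draws cardsT bin_gt0.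
by case/card_gt0P=> T; rewrite inE => /andP[_ /eqP]; exists T.
Qed.

(** Double counting of the pairs [(A, B)] with [A] a [t]-subset of [S] contained in the block
    [B]. *)
Lemma sum_bin_card_inter {t v k l X} {Bs : seq {set X}} (S : {set X}) :
  is_design t v k l Bs ->
  \sum_(B <- Bs) 'C(#|S :&: B|, t) = 'C(#|S|, t) * l.
Proof.
case=> _ _ desBs.
under eq_bigr => B _.
  rewrite -cards_draws -sum1_card.
  rewrite (eq_bigl (fun A => (A \in [set A : {set X} | A \subset S & #|A| == t])
                             && (A \subset B))); last first.
    by move=> A; rewrite !inE subsetI andbAC.
  rewrite big_mkcondr /=; over.
rewrite exchange_big /= -cards_draws -sum_nat_const.
apply: eq_bigr => A; rewrite inE => /andP[_ /eqP cA].
by rewrite -big_mkcond sum1_count desBs.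
Qed.

Lemma sum_ffact_card_inter {t v k l X} {Bs : seq {set X}} (S : {set X}) :
  is_design t v k l Bs ->
  \sum_(B <- Bs) #|S :&: B| ^_ t = #|S| ^_ t * l.
Proof.
move=> des; under eq_bigr do rewrite -bin_ffact.
by rewrite -big_distrl /= (sum_bin_card_inter S des) -bin_ffact mulnAC.
Qed.

(** For each [t]-set [T], count the pairs of a point [x] outside [T] and a block containing
    [x |: T]. Cancelling [k - t > 0] shows that the number of blocks through [T] does not depend on
    [T]. *)
Lemma design_pred {t v k l X} {Bs : seq {set X}} :
  t < k -> t <= v -> is_design t.+1 v k l Bs ->
  exists2 l', is_design t v k l' Bs & l' * (k - t) = (v - t) * l.
Proof.
move=> tk tv [cX kBs desBs].
have cnt (T : {set X}) : #|T| = t ->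
    count (fun B : {set X} => T \subset B) Bs * (k - t) = (v - t) * l.
  move=> cT.
  have -> : v - t = #|~: T| by have := cardsC T; rewrite cX cT; lia.
  rewrite -sum_nat_const -sum1_count big_distrl /=.
  transitivity (\sum_(x in ~: T) \sum_(B <- Bs) (x |: T \subset B)); last first.
    apply: eq_bigr => x; rewrite inE => xT.
    rewrite -(desBs (x |: T)) ?cardsU1 ?xT ?cT // -sum1_count [RHS]big_mkcond.
    by apply: eq_bigr => B _; case: ifP.
  rewrite exchange_big /= big_mkcond /=.
  rewrite !big_seq; apply: eq_bigr => B /kBs cB.
  case: ifP => TB.
    have -> : k - t = #|B :\: T| by rewrite cardsDS ?cB ?cT.
    rewrite mul1n -sum1_card big_mkcond [RHS]big_mkcond /=.
    apply: eq_bigr => x _; rewrite !inE subUset sub1set TB andbT.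
    by case: (x \in T); case: (x \in B).
  by rewrite big1 // => x _; rewrite subUset TB andbF.
have [T cT] : exists T : {set X}, #|T| = t.
  by apply: exists_set_of_card; rewrite cX.
exists (count (fun B : {set X} => T \subset B) Bs); last exact: cnt.
split=> // T' cT'; apply/eqP; rewrite -(@eqn_pmul2r (k - t)) ?subn_gt0 //.
by rewrite !cnt.
Qed.

Local Close Scope nat_scope.

Lemma ffactZ (x n : nat) : (x ^_ n)%:Z = \prod_(i < n) (x%:Z - i%:Z).
Proof.
elim: n => [|n IHn]; first by rewrite big_ord0.
rewrite big_ord_recr /= -IHn ffactnSr PoszM.
have [nx|xn] := leqP n x; first by rewrite subzn.
by rewrite ffact_small ?mul0r.
Qed.

(** The coefficients expand x (x - 2) ... (x - 10) in falling factorials; at [x = 2a] this is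
    [64 * a ^_ 6]. *)
Lemma dvdz_evens_product (x : nat) : ~~ odd x ->
  (1024 %| (x ^_ 6)%:Z - 15 * (x ^_ 5)%:Z + 105 * (x ^_ 4)%:Z
           - 420 * (x ^_ 3)%:Z + 945 * (x ^_ 2)%:Z - 945 * (x ^_ 1)%:Z)%Z.
Proof.
move=> /even_halfK <-; move: (half x) => a.
have dvd64 (s : int) : s = 64 * (a ^_ 6)%:Z -> (1024 %| s)%Z.
  (* Here 45 = 64 * 720 / 1024. *)
  move=> ->; rewrite -bin_ffact PoszM; apply/dvdzP; exists (45 * 'C(a, 6)%:Z).
  by rewrite (_ : (6 `!)%:Z = 720) //; ring.
by apply: dvd64; rewrite !ffactZ !big_ord_recr !big_ord0 /= -muln2 PoszM; ring.
Qed.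

(* For m = 2 N, the sum of the header times the odd denominators of
   lambda_l / lambda_4 is lambda_4 * 32 * (2 * half_cofactor N + 1).
   Numerals in int are unary, so the larger coefficients are split. *)
Definition half_cofactor (N : int) : int :=
    2 ^+ 24 * N ^+ 11 - 2 ^+ 23 * 19 * N ^+ 10
    + 2 ^+ 19 * 1245 * N ^+ 9 - 2 ^+ 16 * (15 * 1469) * N ^+ 8
    + 2 ^+ 12 * (21 * (20 * 1000 + 113)) * N ^+ 7 - 2 ^+ 12 * (1683 * 127) * N ^+ 6
    - 2 ^+ 9 * (25 * (11 * 1000 + 633)) * N ^+ 5 + 2 ^+ 4 * (5465 * 3019) * N ^+ 4
    - 2 ^+ 2 * (81 * 403 * 617) * N ^+ 3 + 2 * (3 * (1797 * 1000 + 373)) * N ^+ 2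
    - (5355 * 127) * N + (16 * 1000 + 537).

Lemma self_orthogonal_6design_dvd_lambda5 {n l6} {X : finType}
    {Bs : seq {set X}} :
  (0 < n)%N -> Bs != [::] ->
  is_self_orthogonal_design 6 (24 * (2 * n)) (4 * (2 * n) + 4) l6 Bs ->
  exists2 l5, (l5 * (4 * (2 * n) - 1) = (24 * (2 * n) - 5) * l6)%N
    & (32 * (2 * n) %| l5)%N.
Proof.
case: Bs => [//|B Bs' n_gt0 _]; set Bs := B :: Bs' => -[des6 orth].
have BBs : B \in Bs by rewrite mem_head.
have cB : (#|B| = 4 * (2 * n) + 4)%N by case: des6 => _ ->.
have [||l5 des5 E5] := design_pred _ _ des6; try lia.
have [||l4 des4 E4] := design_pred _ _ des5; try lia.
have [||l3 des3 E3] := design_pred _ _ des4; try lia.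
have [||l2 des2 E2] := design_pred _ _ des3; try lia.
have [||l1 des1 E1] := design_pred _ _ des2; try lia.
exists l5; first lia.
set k := (4 * (2 * n) + 4)%N in cB.
have dvdS : (1024 %| (k ^_ 6 * l6)%:Z - 15 * (k ^_ 5 * l5)%:Z
    + 105 * (k ^_ 4 * l4)%:Z - 420 * (k ^_ 3 * l3)%:Z
    + 945 * (k ^_ 2 * l2)%:Z - 945 * (k ^_ 1 * l1)%:Z)%Z.
  rewrite -cB -(sum_ffact_card_inter B des6) -(sum_ffact_card_inter B des5).
  rewrite -(sum_ffact_card_inter B des4) -(sum_ffact_card_inter B des3).
  rewrite -(sum_ffact_card_inter B des2) -(sum_ffact_card_inter B des1).
  have sumZ (F : {set X} -> nat) :
    (\sum_(A <- Bs) F A)%N%:Z = \sum_(A <- Bs) (F A)%:Z.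
    by rewrite -natz natr_sum; apply: eq_bigr => A _; rewrite natz.
  rewrite !sumZ !big_distrr /= -!(sumrN, big_split) /=.
  rewrite big_seq; apply: rpred_sum => A ABs.
  apply: dvdz_evens_product; rewrite (orth _ _ BBs ABs) /k; lia.
set N := n%:Z.
(* Common powers of 2 are cancelled, so that the factor next to each left-hand parameter is odd. *)
have F5 : l5%:Z * (12 * N - 1) = l4%:Z * (2 * N) by rewrite /N; lia.
have F6 : l6%:Z * (48 * N - 5) = l5%:Z * (8 * N - 1) by rewrite /N; lia.
have F3 : l3%:Z * (8 * N + 1) = l4%:Z * (48 * N - 3) by rewrite /N; lia.
have F2 : l2%:Z * (4 * N + 1) = l3%:Z * (24 * N - 1) by rewrite /N; lia.
have F1 : l1%:Z * (8 * N + 3) = l2%:Z * (48 * N - 1) by rewrite /N; lia.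
have kN : k%:Z = 8 * N + 4 by rewrite /k /N; lia.
have : (32 * 32 %| l4%:Z * 32)%Z.
  pose W := half_cofactor N.
  have co : coprimez (32 * 32) (2 * W + 1).
    rewrite (_ : 32 * 32 = 2 ^+ 10) // coprimezXl //.
    by apply/coprimezP; exists (- W, 1) => /=; ring.
  rewrite -(Gauss_dvdzl _ co).
  (* Together with [48 * N - 5] and [8 * N + 3], this clears every denominator of the parameters
     relative to [l4]. *)
  pose U := (12 * N - 1) * (8 * N + 1) * (4 * N + 1).
  move: dvdS; set S := (X in (_ %| X)%Z) => dvdS.
  suff -> : l4%:Z * 32 * (2 * W + 1) = S * (U * (48 * N - 5) * (8 * N + 3)).
    by rewrite dvdz_mulr.
  have G6 : l6%:Z * (48 * N - 5) * (12 * N - 1) = l4%:Z * (2 * N * (8 * N - 1)).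
    by rewrite F6 mulrAC F5; ring.
  have G2 : l2%:Z * (4 * N + 1) * (8 * N + 1)
      = l4%:Z * ((48 * N - 3) * (24 * N - 1)).
    by rewrite F2 mulrAC F3; ring.
  have G1 : l1%:Z * (8 * N + 3) * ((4 * N + 1) * (8 * N + 1))
      = l4%:Z * ((48 * N - 3) * (24 * N - 1) * (48 * N - 1)).
    by rewrite F1 mulrAC (mulrA l2%:Z) G2; ring.
  have ffactMZ (x j l : nat) :
    (x ^_ j * l)%:Z = \prod_(i < j) (x%:Z - i%:Z) * l%:Z.
    by rewrite PoszM ffactZ.
  rewrite /S !ffactMZ !big_ord_recr !big_ord0 /= kN.
  pose p1 := 8 * N + 4; pose p2 := p1 * (8 * N + 3); pose p3 := p2 * (8 * N + 2).
  pose p4 := p3 * (8 * N + 1); pose p5 := p4 * (8 * N).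
  pose p6 := p5 * (8 * N - 1).
  (* Each term is regrouped around a left-hand side of [G6], [F5], [F3], [G2] or [G1]; substitution
     leaves [l4] times a polynomial identity in [N]. *)
  transitivity (
      p6 * ((8 * N + 1) * (4 * N + 1) * (8 * N + 3))
        * (l6%:Z * (48 * N - 5) * (12 * N - 1))
    - 15 * p5 * ((8 * N + 1) * (4 * N + 1) * (48 * N - 5) * (8 * N + 3))
        * (l5%:Z * (12 * N - 1))
    + 105 * p4 * (U * (48 * N - 5) * (8 * N + 3)) * l4%:Z
    - 420 * p3 * ((12 * N - 1) * (4 * N + 1) * (48 * N - 5) * (8 * N + 3))
        * (l3%:Z * (8 * N + 1))
    + 945 * p2 * ((12 * N - 1) * (48 * N - 5) * (8 * N + 3))
        * (l2%:Z * (4 * N + 1) * (8 * N + 1))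
    - 945 * p1 * ((12 * N - 1) * (48 * N - 5))
        * (l1%:Z * (8 * N + 3) * ((4 * N + 1) * (8 * N + 1)))).
    rewrite G6 F5 F3 G2 G1 /U /p6 /p5 /p4 /p3 /p2 /p1 /W /half_cofactor; ring.
  rewrite /U /p6 /p5 /p4 /p3 /p2 /p1; ring.
rewrite dvdz_mul2r // => /dvdzP[q l4q].
(* This lets [12 * n - 1] be removed from [F5], whose right-hand side is now a multiple of
   [32 * (2 * n)]. *)
have co5 : coprime (32 * (2 * n)) (12 * n - 1).
  have : coprime (12 * n) (12 * n - 1).
    by rewrite -{1}(@prednK (12 * n)) ?muln_gt0 // -subn1 coprimeSn.
  rewrite !(coprimeMl (12 * n - 1)) => /andP[co12 ->].
  have co2 : coprime 2 (12 * n - 1) by apply: coprime_dvdl co12.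
  by rewrite -[32%N]/(2 ^ 5)%N coprimeXl // co2.
rewrite -(Gauss_dvdl _ co5); apply/dvdnP; exists `|q|%N.
have q_ge0 : 0 <= q by lia.
apply/eqP; rewrite -eqz_nat !PoszM gez0_abs //; apply/eqP.
have -> : (12 * n - 1)%N%:Z = 12 * N - 1 by rewrite /N; lia.
by rewrite F5 l4q /N; ring.
Qed.

(** Legendre's formula with a summation range independent of [n]: the terms added or dropped have
    [n < 2 ^ k] and vanish. *)
Lemma logn2_fact_small (n : nat) : (n < 1024)%N ->
  logn 2 (n`!) = (\sum_(1 <= k < 11) n %/ 2 ^ k)%N.
Proof.
move=> n_lt; rewrite logn_fact //.
have cut a b : (a <= b)%N -> (n < 2 ^ a)%N -> (0 < a)%N ->
    (\sum_(1 <= k < b) n %/ 2 ^ k = \sum_(1 <= k < a) n %/ 2 ^ k)%N.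
  move=> ab na a_gt0; rewrite (big_cat_nat a_gt0 ab) /= [X in (_ + X)%N]big_nat.
  rewrite [X in (_ + X)%N]big1 ?addn0 // => i /andP[ai _]; apply: divn_small.
  by apply: leq_trans na _; rewrite leq_exp2l.
have [n_ge10|n_lt10] := leqP 11 n.+1.
  by rewrite (cut 11) // (leq_trans n_lt).
rewrite (cut n.+1%N 11) //; first exact: ltnW.
by rewrite (leq_trans (ltn_expl n (isT : 1 < 2)%N)) ?leq_exp2l.
Qed.

Theorem theorem4 (m : nat)
    (hm : m \in [:: 8; 40; 42; 50; 74; 76; 80; 86; 100; 130; 144; 150]%N)
    (lambda7 : nat)
    (hlambda7 : (lambda7%:R : rat) =
       'C(5 * m - 2, m - 1)%:R *
       (((4 * m - 1)%:R * (4 * m - 2)%:R) /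
        ((24 * m - 5)%:R * (24 * m - 6)%:R))) :
  ~ exists (X : finType) (Bs : seq {set X}),
      is_self_orthogonal_design 7 (24 * m) (4 * m + 4) lambda7 Bs.
Proof.
pose v2 n := (\sum_(1 <= k < 11) n %/ 2 ^ k)%N.
(* Since [5 * m - 2 <= 748 < 1024], [v2] gives the 2-adic valuations of the factorials involved; the
   strict inequality is what contradicts divisibility by [32 * m]. *)
have /allP/(_ m hm)/and4P[m_gt0 m_le150 /even_halfK m_even v2_lt] :
    all (fun m => [&& 0 < m, m <= 150, ~~ odd m &
                   v2 (5 * m - 2) < 5 + v2 m + v2 (4 * m - 1)])%N
      [:: 8; 40; 42; 50; 74; 76; 80; 86; 100; 130; 144; 150]%N.
  by rewrite /v2 unlock; vm_compute.
have E7 : (lambda7 * ((24 * m - 5) * (24 * m - 6))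
           = 'C(5 * m - 2, m - 1) * ((4 * m - 1) * (4 * m - 2)))%N.
  apply/eqP; rewrite -(Num.Theory.eqr_nat rat) !natrM hlambda7; apply/eqP.
  by field; rewrite !Num.Theory.pnatr_eq0; lia.
case=> X [Bs [des7 orth]].
have [||l6 des6 E6] := design_pred _ _ des7; try lia.
(* An empty family would force [lambda7 = 0], but the prescribed value is positive. *)
have Bs_n0 : Bs != [::].
  apply: contraTneq isT => Bs0.
  have [T cT] : exists T : {set X}, (#|T| = 7)%N.
    by apply: exists_set_of_card; case: des7 => -> _ _; lia.
  case: des7 => _ _ /(_ T cT); rewrite Bs0 /= => lam0.
  have : (0 < 'C(5 * m - 2, m - 1))%N by rewrite bin_gt0; lia.
  have pos2 : (0 < (4 * m - 1) * (4 * m - 2))%N by rewrite muln_gt0; lia.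
  by move=> pos1; have := conj pos1 pos2 => /andP; rewrite -muln_gt0 -E7 -lam0.
have mE : (m = 2 * m./2)%N by rewrite mul2n m_even.
have half_gt0 : (0 < m./2)%N by lia.
move: (@self_orthogonal_6design_dvd_lambda5 _ l6 _ Bs half_gt0 Bs_n0).
rewrite -mE => /(_ (conj des6 orth))[l5 E5 dvd5].
have l5E : (l5 = 'C(5 * m - 2, m - 1))%N.
  apply/eqP; rewrite -(@eqn_pmul2r ((4 * m - 1) * (4 * m - 2))); last first.
    by rewrite muln_gt0; lia.
  have k6 : (4 * m - 2 = 4 * m + 4 - 6)%N by lia.
  by rewrite -E7 mulnA E5 k6 -mulnA E6 mulnA mulnC.
(* Multiplying the divisibility of [l5] by [(m - 1)! (4m - 1)!] absorbs the factor [m] into [m!], so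
   only valuations of factorials remain. *)
have : (32 * (m`! * (4 * m - 1)`!) %| (5 * m - 2)`!)%N.
  have -> : ((5 * m - 2)`! = l5 * ((m - 1)`! * (4 * m - 1)`!))%N.
    rewrite l5E -(@bin_fact (5 * m - 2) (m - 1)); last lia.
    by have -> : (4 * m - 1 = 5 * m - 2 - (m - 1))%N by lia.
  have -> : (m`! = m * (m - 1)`!)%N.
    by rewrite -{1}(prednK m_gt0) factS prednK // subn1.
  by rewrite -mulnA mulnA dvdn_mul.
move=> /(dvdn_leq_log 2 (fact_gt0 _)).
rewrite !lognM ?muln_gt0 ?fact_gt0 // !logn2_fact_small; try lia.
by rewrite (pfactorK 5) // addnA leqNgt v2_lt.
Qed.
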